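(* In the steady state of the discrete-time queue with batch-size-dependent service and single ($\delta_p=0$) or multiple ($\delta_p=1$) vacations described in the context, the bivariate probability generating function $P^+(x,y)=\sum_{n=0}^{\infty}\sum_{r=a}^{b}p^+_{n,r}x^ny^r$ of queue length and server content at service completion epoch satisfies, for all complex $x,y$ with $|x|\le 1$, $|y|\le 1$, $x\neq 0$ and $x^b\ne K^{(b)}(x)$, $$P^+(x,y)=\frac{N(x,y)}{x^b-K^{(b)}(x)},$$ where $$\begin{aligned}N(x,y)=&\sum_{n=0}^{a-1}\Big[p^+_n x^n\{H(x)-1\}y^bK^{(b)}(x)\\&+Q^+_n\Big\{(1-\delta_p)\Big(\big(x^b-K^{(b)}(x)\big)y^a+y^bK^{(b)}(x)\Big)K^{(a)}(x)+\big(\delta_pH(x)-1\big)x^ny^bK^{(b)}(x)\Big\}\Big]\\ &+\sum_{n=a}^{b-1}(p^+_n+Q^+_n)\Big\{\big(x^b-K^{(b)}(x)\big)\big(y^nK^{(n)}(x)-x^{n-b}y^bK^{(b)}(x)\big)+\big(K^{(n)}(x)-x^{n-b}K^{(b)}(x)\big)y^bK^{(b)}(x)\Big\}.\end{aligned}$$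
   Context: Parameters: integers $1\le a\le b$; $0<\lambda<1$, $\bar\lambda=1-\lambda$ (Bernoulli arrivals, one customer per slot with probability $\lambda$); $\delta_p\in\{0,1\}$ ($0$: single vacation, $1$: multiple vacation). For $a\le r\le b$, the service time of a batch of size $r$ has pmf $s_r(u)$, $u\ge1$, pgf $S_r^*(z)=\sum_{u\ge1}s_r(u)z^u$ and finite mean $s_r=1/\mu_r$; a vacation has pmf $v(u)$, $u\ge 1$, pgf $V^*(z)=\sum_{u\ge1}v(u)z^u$ and finite mean $E(V)$. Stability: $\lambda/(b\mu_b)<1$. Customers are served in batches by the $(a,b)$ rule: service starts only if at least $a$ customers wait; all are taken if there are between $a$ and $b$, otherwise exactly $b$. After a service, if fewer than $a$ wait, the server takes a vacation; if fewer than $a$ wait at the end of a vacation, the server stays dormant until $a$ have accumulated (single vacation) or takes another vacation (multiple vacation). The system is late arrival with delayed access: in each slot a potential arrival occurs just before, and a potential departure just after, the slot boundary. Steady-state probabilities just before a slot boundary: $p_{n,0}$ ($0\le n\le a-1$): server dormant, $n$ in queue; $p_{n,r}(u)$ ($n\ge0$, $a\le r\le b$, $u\ge1$): server busy with a batch of $r$, remaining service time $u$, $n$ in queue; $Q_n(u)$ ($n\ge0,u\ge1$): server on vacation with remaining vacation time $u$, $n$ in queue. They are nonnegative, satisfy $$p_{0,0}=(1-\delta_p)\bar\lambda\,(p_{0,0}+Q_0(1)),$$ $$p_{n,0}=(1-\delta_p)\big[\bar\lambda p_{n,0}+\lambda p_{n-1,0}+\bar\lambda Q_n(1)+\lambda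 Q_{n-1}(1)\big],\quad 1\le n\le a-1,$$ $$p_{0,a}(u)=\bar\lambda p_{0,a}(u+1)+\Big[\sum_{m=a}^b(\bar\lambda p_{a,m}(1)+\lambda p_{a-1,m}(1))+\bar\lambda Q_a(1)+\lambda Q_{a-1}(1)+(1-\delta_p)\lambda p_{a-1,0}\Big]s_a(u),$$ $$p_{0,r}(u)=\bar\lambda p_{0,r}(u+1)+\Big[\sum_{m=a}^b(\bar\lambda p_{r,m}(1)+\lambda p_{r-1,m}(1))+\bar\lambda Q_r(1)+\lambda Q_{r-1}(1)\Big]s_r(u),\quad a+1\le r\le b,$$ $$p_{n,r}(u)=\bar\lambda p_{n,r}(u+1)+\lambda p_{n-1,r}(u+1),\quad n\ge1,\ a\le r\le b-1,$$ $$p_{n,b}(u)=\bar\lambda p_{n,b}(u+1)+\lambda p_{n-1,b}(u+1)+\Big[\sum_{m=a}^b(\bar\lambda p_{n+b,m}(1)+\lambda p_{n+b-1,m}(1))+\bar\lambda Q_{n+b}(1)+\lambda Q_{n+b-1}(1)\Big]s_b(u),\quad n\ge1,$$ $$Q_0(u)=\bar\lambda Q_0(u+1)+\bar\lambda\Big[\sum_{m=a}^bp_{0,m}(1)+\delta_pQ_0(1)\Big]v(u),$$ $$Q_n(u)=\bar\lambda Q_n(u+1)+\lambda Q_{n-1}(u+1)+\Big[\sum_{m=a}^b(\bar\lambda p_{n,m}(1)+\lambda p_{n-1,m}(1))+\delta_p(\bar\lambda Q_n(1)+\lambda Q_{n-1}(1))\Big]v(u),\quad 1\le n\le a-1,$$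 $$Q_n(u)=\bar\lambda Q_n(u+1)+\lambda Q_{n-1}(u+1),\quad n\ge a,$$ and, with $p_{n,r}=\sum_{u\ge1}p_{n,r}(u)$ and $Q_n=\sum_{u\ge1}Q_n(u)$, the normalization $(1-\delta_p)\sum_{n=0}^{a-1}p_{n,0}+\sum_{n\ge0}\sum_{r=a}^bp_{n,r}+\sum_{n\ge0}Q_n=1$. Epoch probabilities: with $\tau=\sum_{m\ge0}\sum_{r=a}^bp_{m,r}(1)+\sum_{m\ge0}Q_m(1)$, set $p^+_{0,r}=\tau^{-1}\bar\lambda p_{0,r}(1)$, $p^+_{n,r}=\tau^{-1}(\bar\lambda p_{n,r}(1)+\lambda p_{n-1,r}(1))$ for $n\ge1$ (service completion of a batch of size $r$ leaving $n$ in queue), $p_n^+=\sum_{r=a}^bp^+_{n,r}$, and $Q_0^+=\tau^{-1}\bar\lambda Q_0(1)$, $Q_n^+=\tau^{-1}(\bar\lambda Q_n(1)+\lambda Q_{n-1}(1))$ for $n\ge1$ (vacation termination with $n$ in queue). Finally $K^{(r)}(x)=S_r^*(\bar\lambda+\lambda x)=\sum_{j\ge0}k_j^{(r)}x^j$ for $a\le r\le b$ and $H(x)=V^*(\bar\lambda+\lambda x)=\sum_{j\ge0}h_jx^j$ (pgfs of the number of arrivals during a service of a batch of size $r$, respectively during a vacation). *)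

(* Defs.v *)
From Stdlib Require Import Reals Lra Lia.
From Coquelicot Require Import Coquelicot.
Open Scope R_scope.

(** Distributions on {1, 2, ...} are functions [f : nat -> R] whose value at 0
    is never used: a sum over [u >= 1] of [f u] is the series of [f (S u)]. *)
Definition is_pmf (f : nat -> R) : Prop :=
  (forall u : nat, (1 <= u)%nat -> 0 <= f u) /\
  is_series (fun u => f (S u)) 1.

Definition finite_mean (f : nat -> R) : Prop :=
  ex_series (fun u => INR (S u) * f (S u)).

Definition mean (f : nat -> R) : R :=
  Series (fun u => INR (S u) * f (S u)).

Record model (a b : nat) (lam delta : R) (s : nat -> nat -> R) (v : nat -> R)
    : Prop := {
  a_pos : (1 <= a)%nat;
  a_le_b : (a <= b)%nat;
  lam_range : 0 < lam < 1;
  delta_01 : delta = 0 \/ delta = 1;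
  service_pmf : forall r, (a <= r <= b)%nat -> is_pmf (s r);
  service_mean : forall r, (a <= r <= b)%nat -> finite_mean (s r);
  vacation_pmf : is_pmf v;
  vacation_mean : finite_mean v;
  stability : let mu_b := / mean (s b) in lam / (INR b * mu_b) < 1
}.

(** [p0 n] is p_{n,0}, [p n r u] is p_{n,r}(u), [Q n u] is Q_n(u).
    As [Series] is a total operator, the convergence of the series occurring in
    the normalization is required separately, by [busy_summable_u] to
    [vacation_summable]. *)
Record steady_state (a b : nat) (lam delta : R) (s : nat -> nat -> R)
    (v : nat -> R) (p0 : nat -> R) (p : nat -> nat -> nat -> R)
    (Q : nat -> nat -> R) : Prop := {
  dormant_nonneg : forall n, (n <= a - 1)%nat -> 0 <= p0 n;
  busy_nonneg : forall n r u, (a <= r <= b)%nat -> (1 <= u)%nat -> 0 <= p n r u;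
  vacation_nonneg : forall n u, (1 <= u)%nat -> 0 <= Q n u;
  dormant_0 :
    p0 0%nat = (1 - delta) * ((1 - lam) * (p0 0%nat + Q 0%nat 1%nat));
  dormant_n : forall n, (1 <= n <= a - 1)%nat ->
    p0 n = (1 - delta) *
      ((1 - lam) * p0 n + lam * p0 (n - 1)%nat
       + (1 - lam) * Q n 1%nat + lam * Q (n - 1)%nat 1%nat);
  busy_0_a : forall u, (1 <= u)%nat ->
    p 0%nat a u = (1 - lam) * p 0%nat a (u + 1)%nat
      + (sum_n_m (fun m => (1 - lam) * p a m 1%nat
                           + lam * p (a - 1)%nat m 1%nat) a b
         + (1 - lam) * Q a 1%nat + lam * Q (a - 1)%nat 1%nat
         + (1 - delta) * lam * p0 (a - 1)%nat) * s a u;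
  busy_0_r : forall r u, (a + 1 <= r <= b)%nat -> (1 <= u)%nat ->
    p 0%nat r u = (1 - lam) * p 0%nat r (u + 1)%nat
      + (sum_n_m (fun m => (1 - lam) * p r m 1%nat
                           + lam * p (r - 1)%nat m 1%nat) a b
         + (1 - lam) * Q r 1%nat + lam * Q (r - 1)%nat 1%nat) * s r u;
  busy_n_r : forall n r u,
    (1 <= n)%nat -> (a <= r <= b - 1)%nat -> (1 <= u)%nat ->
    p n r u = (1 - lam) * p n r (u + 1)%nat + lam * p (n - 1)%nat r (u + 1)%nat;
  busy_n_b : forall n u, (1 <= n)%nat -> (1 <= u)%nat ->
    p n b u = (1 - lam) * p n b (u + 1)%nat + lam * p (n - 1)%nat b (u + 1)%nat
      + (sum_n_m (fun m => (1 - lam) * p (n + b)%nat m 1%nat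
                           + lam * p (n + b - 1)%nat m 1%nat) a b
         + (1 - lam) * Q (n + b)%nat 1%nat
         + lam * Q (n + b - 1)%nat 1%nat) * s b u;
  vacation_0 : forall u, (1 <= u)%nat ->
    Q 0%nat u = (1 - lam) * Q 0%nat (u + 1)%nat
      + (1 - lam) * (sum_n_m (fun m => p 0%nat m 1%nat) a b
                     + delta * Q 0%nat 1%nat) * v u;
  vacation_lt_a : forall n u, (1 <= n <= a - 1)%nat -> (1 <= u)%nat ->
    Q n u = (1 - lam) * Q n (u + 1)%nat + lam * Q (n - 1)%nat (u + 1)%nat
      + (sum_n_m (fun m => (1 - lam) * p n m 1%nat
                           + lam * p (n - 1)%nat m 1%nat) a b
         + delta * ((1 - lam) * Q n 1%nat + lam * Q (n - 1)%nat 1%nat)) * v u;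
  vacation_ge_a : forall n u, (a <= n)%nat -> (1 <= u)%nat ->
    Q n u = (1 - lam) * Q n (u + 1)%nat + lam * Q (n - 1)%nat (u + 1)%nat;
  busy_summable_u : forall n r, (a <= r <= b)%nat ->
    ex_series (fun u => p n r (S u));
  vacation_summable_u : forall n, ex_series (fun u => Q n (S u));
  busy_summable :
    ex_series (fun n => sum_n_m (fun r => Series (fun u => p n r (S u))) a b);
  vacation_summable : ex_series (fun n => Series (fun u => Q n (S u)));
  normalization :
    (1 - delta) * sum_n_m p0 0 (a - 1)
    + Series (fun n => sum_n_m (fun r => Series (fun u => p n r (S u))) a b)
    + Series (fun n => Series (fun u => Q n (S u))) = 1
}.

Definition tau (a b : nat) (p : nat -> nat -> nat -> R) (Q : nat -> nat -> R)
    : R :=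
  Series (fun m => sum_n_m (fun r => p m r 1%nat) a b)
  + Series (fun m => Q m 1%nat).

(** p^+_{n,r} *)
Definition pplus (a b : nat) (lam : R) (p : nat -> nat -> nat -> R)
    (Q : nat -> nat -> R) (n r : nat) : R :=
  match n with
  | O => / tau a b p Q * ((1 - lam) * p 0%nat r 1%nat)
  | S k => / tau a b p Q * ((1 - lam) * p n r 1%nat + lam * p k r 1%nat)
  end.

(** p^+_n *)
Definition pplus_tot (a b : nat) (lam : R) (p : nat -> nat -> nat -> R)
    (Q : nat -> nat -> R) (n : nat) : R :=
  sum_n_m (fun r => pplus a b lam p Q n r) a b.

(** Q^+_n *)
Definition Qplus (a b : nat) (lam : R) (p : nat -> nat -> nat -> R)
    (Q : nat -> nat -> R) (n : nat) : R :=
  match n with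
  | O => / tau a b p Q * ((1 - lam) * Q 0%nat 1%nat)
  | S k => / tau a b p Q * ((1 - lam) * Q n 1%nat + lam * Q k 1%nat)
  end.

Open Scope C_scope.

(** Sum of a complex series, meaningful when the series converges. *)
Definition CSeries (c : nat -> C) : C :=
  (Series (fun n => Re (c n)), Series (fun n => Im (c n))).

Lemma sum_n_Re_Im (c : nat -> C) (n : nat) :
  sum_n c n = (sum_n (fun k => Re (c k)) n, sum_n (fun k => Im (c k)) n) :> C.
Proof.
induction n as [|n IH].
- rewrite !sum_O. now destruct (c O).
- rewrite !sum_Sn, IH. now destruct (c (S n)).
Qed.

Lemma CSeries_unique (c : nat -> C) (l : C) :
  @is_series C_AbsRing C_NormedModule c l -> CSeries c = l.
Proof.
intros H. unfold CSeries.
destruct l as [l1 l2].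
assert (Hb : forall eps : posreal, eventually (fun n =>
    Rabs (sum_n (fun k => Re (c k)) n - l1) < eps /\
    Rabs (sum_n (fun k => Im (c k)) n - l2) < eps)).
{ intros eps.
  specialize (H (ball ((l1, l2) : C_UniformSpace) eps)
                (locally_ball ((l1, l2) : C_UniformSpace) eps)).
  destruct H as [N HN]. exists N. intros n Hn. specialize (HN n Hn).
  rewrite sum_n_Re_Im in HN. exact HN. }
f_equal; apply is_series_unique; intros P [eps HP].
- destruct (Hb eps) as [N HN]. exists N. intros n Hn. apply HP, HN, Hn.
- destruct (Hb eps) as [N HN]. exists N. intros n Hn. apply HP, HN, Hn.
Qed.

(** Probability generating function of a distribution on {1, 2, ...}. *)
Definition pgf (f : nat -> R) (z : C) : C :=
  CSeries (fun u => RtoC (f (S u)) * z ^ (S u)).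

(** With [f = s r] this is K^{(r)}(x); with [f = v] it is H(x). *)
Definition arrivals_pgf (lam : R) (f : nat -> R) (x : C) : C :=
  pgf f (RtoC (1 - lam) + RtoC lam * x).

Definition PGFplus_term (a b : nat) (lam : R) (p : nat -> nat -> nat -> R)
    (Q : nat -> nat -> R) (x y : C) (n : nat) : C :=
  sum_n_m (fun r => RtoC (pplus a b lam p Q n r) * x ^ n * y ^ r) a b.

(** P^+(x,y) *)
Definition PGFplus (a b : nat) (lam : R) (p : nat -> nat -> nat -> R)
    (Q : nat -> nat -> R) (x y : C) : C :=
  CSeries (PGFplus_term a b lam p Q x y).

(** N(x,y).  The power x^{n-b}, which has n < b here, is written
    [/ x ^ (b - n)]; the second sum is empty when [a = b]. *)
Definition numerator (a b : nat) (lam delta : R) (s : nat -> nat -> R)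
    (v : nat -> R) (p : nat -> nat -> nat -> R) (Q : nat -> nat -> R)
    (x y : C) : C :=
  let K := fun r => arrivals_pgf lam (s r) x in
  let H := arrivals_pgf lam v x in
  let pp := fun n => RtoC (pplus_tot a b lam p Q n) in
  let Qp := fun n => RtoC (Qplus a b lam p Q n) in
  let d := RtoC delta in
  sum_n_m (fun n =>
      pp n * x ^ n * (H - 1) * y ^ b * K b
      + Qp n * ((1 - d) * ((x ^ b - K b) * y ^ a + y ^ b * K b) * K a
                + (d * H - 1) * x ^ n * y ^ b * K b)) 0 (a - 1)
  + sum_n_m (fun n =>
      (pp n + Qp n)
      * ((x ^ b - K b) * (y ^ n * K n - / x ^ (b - n) * y ^ b * K b)
         + (K n - / x ^ (b - n) * K b) * y ^ b * K b)) a (b - 1).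

(* Main.v *)
Require Import Defs.
From Stdlib Require Import Reals Lra Lia.
From Coquelicot Require Import Coquelicot.
Open Scope C_scope.

(** For a fixed kind of batch (or for vacations), let [F u] be the generating
    function in [x] of the states with remaining time [u], and put
    [w = 1 - lam + lam x].  The balance equations read [F u = w F (u + 1) + G s(u)],
    where [G] collects the states from which the service starts.  Since
    [F u -> 0], multiplying by [w^u] and summing over [u] telescopes to
    [w F 1 = G K(x)], and [w F 1] is the generating function at completion epochs.
    For [r < b] the factor [G] is a constant, for vacations a polynomial in the
    first [a] epoch probabilities, and for [r = b] it is [x^{-b}] times the tail
    from [b] of the generating function of all epochs.  The last equation is then
    linear in the unknown transform of the batches of size [b].  The dormant
    states enter only through [lam p_{a-1,0}], which by their own equations is the
    sum of the [Q_n], [n < a], up to normalization.  The constant [1 / tau]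
    plays no role because all these relations are homogeneous. *)

(** * Convergence and bounds for complex series *)

Notation is_Cseries c l := (@is_series C_AbsRing C_NormedModule c l).

Lemma is_Cseries_ext (c d : nat -> C) (l l' : C) :
  (forall n, c n = d n) -> l = l' -> is_Cseries c l -> is_Cseries d l'.
Proof. intros Hcd <-. exact (is_series_ext c d l Hcd). Qed.

Lemma is_Cseries_plus (c d : nat -> C) (l m : C) :
  is_Cseries c l -> is_Cseries d m -> is_Cseries (fun n => c n + d n) (l + m).
Proof. exact (is_series_plus c d l m). Qed.

Lemma is_Cseries_scal (k : C) (c : nat -> C) (l : C) :
  is_Cseries c l -> is_Cseries (fun n => k * c n) (k * l).
Proof. exact (is_series_scal k c l). Qed.

Lemma is_Cseries_unique (c : nat -> C) (l m : C) :
  is_Cseries c l -> is_Cseries c m -> l = m.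
Proof. intros Hl Hm. now rewrite <- (CSeries_unique c l Hl), (CSeries_unique c m Hm). Qed.

Lemma is_series_sum_n_m {K : AbsRing} {V : NormedModule K}
    (F : nat -> nat -> V) (L : nat -> V) (a b : nat) :
  (forall r, (a <= r <= b)%nat -> is_series (F r) (L r)) ->
  is_series (fun n => sum_n_m (fun r => F r n) a b) (sum_n_m L a b).
Proof.
  intros HF.
  destruct (Nat.lt_ge_cases b a) as [Hba | Hab].
  - apply is_series_ext with (fun _ : nat => @zero V).
    { intros n. now rewrite sum_n_m_zero. }
    rewrite sum_n_m_zero by easy.
    apply filterlim_ext with (fun _ : nat => @zero V).
    { intros n. unfold sum_n. now rewrite sum_n_m_const_zero. }
    apply filterlim_const.
  - revert HF. induction Hab as [| b Hab IH]; intros HF.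
    + rewrite sum_n_n. apply is_series_ext with (F a); [| apply HF; lia].
      intros n. now rewrite sum_n_n.
    + rewrite sum_n_Sm by lia.
      apply is_series_ext
        with (fun n => plus (sum_n_m (fun r => F r n) a b) (F (S b) n)).
      { intros n. now rewrite sum_n_Sm by lia. }
      apply is_series_plus; [apply IH; intros r Hr |]; apply HF; lia.
Qed.

(** Form suited to telescoping: the distance of a partial sum to the limit is a remainder whose
    modulus has a real bound tending to 0. *)
Lemma is_Cseries_of_error (c : nat -> C) (l : C) (e : nat -> R) :
  (forall n, Cmod (sum_n c n - l) <= e n)%R -> is_lim_seq e 0%R ->
  is_Cseries c l.
Proof.
  intros He He0.
  assert (H0 : filterlim (fun n => minus (sum_n c n) l : C_NormedModule)
                 eventually (locally (zero : C_NormedModule))).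
  { apply filterlim_norm_zero.
    apply (is_lim_seq_le_le (fun _ => 0%R) _ e 0%R); [| apply is_lim_seq_const | easy].
    intros n. split; [apply norm_ge_0 | apply He]. }
  unfold is_series.
  replace (l : C_NormedModule) with (plus zero l : C_NormedModule) by apply plus_zero_l.
  apply filterlim_ext with (fun n => plus (minus (sum_n c n) l) l : C_NormedModule).
  { intros n. unfold minus. now rewrite <- plus_assoc, plus_opp_l, plus_zero_r. }
  eapply filterlim_comp_2; [exact H0 | apply filterlim_const |].
  apply (@filterlim_plus C_AbsRing C_NormedModule).
Qed.

Lemma Cmod_is_Cseries_le (c : nat -> C) (l : C) (d : nat -> R) :
  (forall n, Cmod (c n) <= d n)%R -> ex_series d -> is_Cseries c l ->
  (Cmod l <= Series d)%R.
Proof.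
  intros Hcd Hd Hc.
  apply (is_lim_seq_le (fun n => Cmod (sum_n c n)) (sum_n d) (Cmod l) (Series d)).
  - intros n. eapply Rle_trans; [apply (@norm_sum_n_m C_AbsRing C_NormedModule) |].
    apply sum_n_m_le, Hcd.
  - eapply (filterlim_comp _ _ _ (sum_n c : nat -> C_NormedModule)
              (@norm C_AbsRing C_NormedModule)).
    + exact Hc.
    + apply (@filterlim_norm C_AbsRing C_NormedModule).
  - now apply Series_correct.
Qed.

Lemma Cmod_pow_le_1 (z : C) (n : nat) : (Cmod z <= 1)%R -> (Cmod (z ^ n) <= 1)%R.
Proof.
  intros Hz. rewrite Cmod_pow. rewrite <- (pow1 n).
  apply pow_incr. split; [apply Cmod_ge_0 | easy].
Qed.

Lemma Cmod_nonneg_coef_le (g : R) (z : C) :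
  (0 <= g)%R -> (Cmod z <= 1)%R -> (Cmod (RtoC g * z) <= g)%R.
Proof.
  intros Hg Hz. rewrite Cmod_mult, Cmod_R, Rabs_pos_eq by easy.
  rewrite <- (Rmult_1_r g) at 2. now apply Rmult_le_compat_l.
Qed.

Lemma ex_series_nonneg_le (g h : nat -> R) :
  (forall n, 0 <= g n <= h n)%R -> ex_series h -> ex_series g.
Proof.
  intros Hgh. apply (ex_series_le (V := R_CompleteNormedModule)).
  intros n. change (Rabs (g n) <= h n)%R. rewrite Rabs_pos_eq; apply Hgh.
Qed.

(** The exponent map [e] covers both uses: the identity for queue lengths, and [S] for times, which
    start at 1. Absolute convergence comes from |x| <= 1. *)
Lemma power_series_CSeries (g : nat -> R) (e : nat -> nat) (x : C) :
  (forall n, 0 <= g n)%R -> ex_series g -> (Cmod x <= 1)%R ->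
  is_Cseries (fun n => RtoC (g n) * x ^ e n) (CSeries (fun n => RtoC (g n) * x ^ e n)).
Proof.
  intros Hg Hs Hx.
  assert (H : @ex_series C_AbsRing C_NormedModule (fun n => RtoC (g n) * x ^ e n)).
  { apply (ex_series_le (V := C_CompleteNormedModule)
             (fun n => RtoC (g n) * x ^ e n) g); [| easy].
    intros n. apply Cmod_nonneg_coef_le; [apply Hg | now apply Cmod_pow_le_1]. }
  destruct H as [l Hl]. now rewrite (CSeries_unique _ l Hl).
Qed.

(** * Nonnegative series and double series *)

Lemma sum_n_nonneg (g : nat -> R) (N : nat) :
  (forall n, 0 <= g n)%R -> (0 <= sum_n g N)%R.
Proof.
  intros Hg. induction N as [| N IH]; [rewrite sum_O; apply Hg |].
  rewrite sum_Sn. change (0 <= sum_n g N + g (S N))%R.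
  specialize (Hg (S N)). lra.
Qed.

Lemma partial_sum_le_Series (g : nat -> R) (N : nat) :
  (forall n, 0 <= g n)%R -> ex_series g -> (sum_n g N <= Series g)%R.
Proof.
  intros Hg Hs.
  apply (is_lim_seq_incr_compare (sum_n g)); [now apply Series_correct |].
  intros n. rewrite sum_Sn. change (sum_n g n <= sum_n g n + g (S n))%R.
  specialize (Hg (S n)). lra.
Qed.

Lemma term_le_Series (g : nat -> R) (n : nat) :
  (forall n, 0 <= g n)%R -> ex_series g -> (g n <= Series g)%R.
Proof.
  intros Hg Hs. eapply Rle_trans; [| apply (partial_sum_le_Series g n Hg Hs)].
  destruct n as [| n]; [rewrite sum_O; lra |].
  rewrite sum_Sn. change (g (S n) <= sum_n g n + g (S n))%R.
  assert (H := sum_n_nonneg g n Hg). lra.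
Qed.

(** Rows are indexed by queue length and columns by remaining time. Summability is stated by rows,
    as in the normalization of the steady state. *)
Definition doubly_summable (f : nat -> nat -> R) : Prop :=
  (forall n u, 0 <= f n u)%R /\
  (forall n, ex_series (f n)) /\
  ex_series (fun n => Series (f n)).

Lemma ex_series_column (f : nat -> nat -> R) (u : nat) :
  doubly_summable f -> ex_series (fun n => f n u).
Proof.
  intros (Hpos & Hrow & Htot).
  apply ex_series_nonneg_le with (fun n => Series (f n)); [| easy].
  intros n. split; [apply Hpos | now apply term_le_Series].
Qed.

(** Half of Tonelli's theorem suffices: any finite number of column sums add up to at most the total
    of the row sums. So the series of column sums converges, and its terms tend to 0. *)
Lemma is_lim_column_sum_0 (f : nat -> nat -> R) :
  doubly_summable f -> is_lim_seq (fun u => Series (fun n => f n u)) 0%R.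
Proof.
  intros Hf. assert (Hcol := fun u => ex_series_column f u Hf).
  destruct Hf as (Hpos & Hrow & Htot).
  apply ex_series_lim_0.
  enough (H : ex_finite_lim_seq (sum_n (fun u => Series (fun n => f n u)))).
  { destruct H as [l Hl]. now exists l. }
  apply ex_finite_lim_seq_incr with (Series (fun n => Series (f n))).
  - intros U. rewrite sum_Sn.
    assert (H := partial_sum_le_Series (fun n => f n (S U)) 0
                   (fun n => Hpos n (S U)) (Hcol (S U))).
    rewrite sum_O in H. specialize (Hpos 0%nat (S U)).
    set (t := sum_n _ U). change (t <= t + Series (fun n => f n (S U)))%R. lra.
  (* A finite sum of columns is exchanged with the series over rows; each row then contributes a
     partial sum, at most the full row sum. *)
  - intros U.
    assert (HU : is_series (fun n => sum_n (f n) U)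
                   (sum_n (fun u => Series (fun n => f n u)) U)).
    { apply (is_series_sum_n_m (fun u n => f n u)).
      intros u _. apply Series_correct, Hcol. }
    rewrite <- (is_series_unique _ _ HU).
    apply Series_le; [| easy].
    intros n. split; [now apply sum_n_nonneg | now apply partial_sum_le_Series].
Qed.

(** * Arrivals, and telescoping over the remaining time *)

(** The potential arrival of a slot turns queue length [n] into [n] with
    probability [1 - lam] and into [n + 1] with probability [lam]. *)
Definition with_arrival (lam : R) (g : nat -> R) (n : nat) : R :=
  match n with
  | O => (1 - lam) * g O
  | S k => (1 - lam) * g n + lam * g k
  end.

Lemma is_Cseries_with_arrival (lam : R) (g : nat -> R) (x G : C) :
  is_Cseries (fun n => RtoC (g n) * x ^ n) G ->
  is_Cseries (fun n => RtoC (with_arrival lam g n) * x ^ n)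
    ((RtoC (1 - lam) + RtoC lam * x) * G).
Proof.
  intros HG.
  (* The part with an arrival: coefficients move up by one and the constant term is 0, which is
     multiplication by [x]. *)
  assert (Hshift : is_Cseries (fun n => match n return C with
                                        | O => 0
                                        | S k => RtoC (g k) * x ^ S k
                                        end) (x * G)).
  { apply (is_series_decr_1 (K := C_AbsRing) (V := C_NormedModule)).
    apply (is_Cseries_ext (fun n => x * (RtoC (g n) * x ^ n)) _ (x * G)).
    - intros n. rewrite Cpow_S. ring.
    - change (x * G = x * G + - 0). ring.
    - now apply is_Cseries_scal. }
  eapply is_Cseries_ext;
    [ | | apply is_Cseries_plus;
          [ apply (is_Cseries_scal (RtoC (1 - lam))), HG
          | apply (is_Cseries_scal (RtoC lam)), Hshift ] ].
  - intros [| n]; cbn beta iota; unfold with_arrival.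
    + rewrite RtoC_mult. ring.
    + rewrite RtoC_plus, !RtoC_mult. ring.
  - cbn beta. ring.
Qed.

Lemma Cmod_thinning_le_1 (lam : R) (x : C) :
  (0 < lam < 1)%R -> (Cmod x <= 1)%R ->
  (Cmod (RtoC (1 - lam) + RtoC lam * x) <= 1)%R.
Proof.
  intros Hlam Hx. eapply Rle_trans; [apply Cmod_triangle |].
  assert (H := Cmod_nonneg_coef_le lam x (Rlt_le _ _ (proj1 Hlam)) Hx).
  rewrite Cmod_R, Rabs_pos_eq by lra. lra.
Qed.

Lemma is_Cseries_arrivals_pgf (lam : R) (s : nat -> R) (x : C) :
  (0 < lam < 1)%R -> is_pmf s -> (Cmod x <= 1)%R ->
  is_Cseries (fun u => RtoC (s (S u)) * (RtoC (1 - lam) + RtoC lam * x) ^ S u)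
    (arrivals_pgf lam s x).
Proof.
  intros Hlam [Hs0 Hs1] Hx.
  apply (power_series_CSeries (fun u => s (S u)) S).
  - intros n. apply Hs0. lia.
  - now exists 1%R.
  - now apply Cmod_thinning_le_1.
Qed.

(** Common to every batch size and to vacations: [f n u] is the state probability and [g n] the
    inflow of new services or vacations that begin with queue length [n]. *)
Lemma completion_pgf (lam : R) (f : nat -> nat -> R) (g s : nat -> R) (x G : C) :
  (0 < lam < 1)%R -> (Cmod x <= 1)%R -> is_pmf s ->
  doubly_summable (fun n u => f n (S u)) ->
  (forall n u, (1 <= u)%nat ->
     f n u = (with_arrival lam (fun k => f k (u + 1)%nat) n + g n * s u)%R) ->
  is_Cseries (fun n => RtoC (g n) * x ^ n) G ->
  is_Cseries (fun n => RtoC (with_arrival lam (fun k => f k 1%nat) n) * x ^ n)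
    (G * arrivals_pgf lam s x).
Proof.
  intros Hlam Hx Hs Hf Hbal HG.
  set (w := RtoC (1 - lam) + RtoC lam * x).
  (* Index shift: [F u] belongs to remaining time [u + 1]. *)
  set (F := fun u => CSeries (fun n => RtoC (f n (S u)) * x ^ n)).
  assert (HF : forall u, is_Cseries (fun n => RtoC (f n (S u)) * x ^ n) (F u)).
  { intros u. apply (power_series_CSeries (fun n => f n (S u)) (fun n => n)); [| | easy].
    - intros n. apply (proj1 Hf).
    - apply (ex_series_column _ u Hf). }
  assert (Hrec : forall u, F u = w * F (S u) + RtoC (s (S u)) * G).
  { intros u. eapply is_Cseries_unique; [apply HF |].
    eapply is_Cseries_ext;
      [ | reflexivity | apply is_Cseries_plus;
            [ apply (is_Cseries_with_arrival lam), (HF (S u))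
            | apply (is_Cseries_scal (RtoC (s (S u)))), HG ] ].
    intros n. cbn beta. rewrite (Hbal n (S u)) by lia.
    replace (S u + 1)%nat with (S (S u)) by lia.
    rewrite RtoC_plus, RtoC_mult. ring. }
  (* The partial sum covers the times 1 to [U + 1], so what remains is the generating function at
     time [U + 2], namely [F (S U)]. *)
  assert (Htel : forall U, sum_n (fun u => G * (RtoC (s (S u)) * w ^ S u)) U
                           = w * F 0%nat - w ^ S (S U) * F (S U) :> C).
  { induction U as [| U IH].
    - rewrite sum_O, (Hrec 0%nat), !Cpow_S. simpl. ring.
    - rewrite sum_Sn, IH, (Hrec (S U)).
      match goal with |- @plus _ ?t ?t' = ?r => change (t + t' = r) end.
      rewrite !Cpow_S. ring. }
  replace (G * arrivals_pgf lam s x) with (w * F 0%nat).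
  { apply (is_Cseries_with_arrival lam), (HF 0%nat). }
  (* One series has two sums: the service pgf times [G], and the limit [w * F 0] of the telescoped
     partial sums. *)
  eapply is_Cseries_unique with (fun u => G * (RtoC (s (S u)) * w ^ S u)).
  2: { apply is_Cseries_scal. now apply is_Cseries_arrivals_pgf. }
  (* Since |w| <= 1 and |x| <= 1, the remainder is at most a column sum of [f], which tends to 0. *)
  apply is_Cseries_of_error with (fun U => Series (fun n => f n (S (S U)))).
  - intros U. rewrite Htel.
    replace (_ - _) with (- (w ^ S (S U) * F (S U))) by ring.
    rewrite Cmod_opp, Cmod_mult, <- Rmult_1_l.
    apply Rmult_le_compat; try apply Cmod_ge_0.
    + apply Cmod_pow_le_1. now apply Cmod_thinning_le_1.
    + apply (Cmod_is_Cseries_le _ _ (fun n => f n (S (S U)))) with (3 := HF (S U)).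
      * intros n. apply Cmod_nonneg_coef_le; [apply (proj1 Hf) | now apply Cmod_pow_le_1].
      * apply (ex_series_column _ (S U) Hf).
  - apply (is_lim_seq_incr_1 (fun u => Series (fun n => f n (S u)))).
    apply (is_lim_column_sum_0 _ Hf).
Qed.

(** * Finite sums, and elimination of the transform of size [b] *)

(* [ring] does not see that the carrier of the canonical structure is [C]. *)
Ltac Cring := match goal with |- @eq _ ?u ?v => change (@eq C u v) end; ring.

Lemma Csum_plus (u w : nat -> C) (n m : nat) :
  sum_n_m (fun k => u k + w k) n m = sum_n_m u n m + sum_n_m w n m.
Proof. exact (sum_n_m_plus u w n m). Qed.

Lemma Csum_scal (k : C) (u : nat -> C) (n m : nat) :
  sum_n_m (fun i => k * u i) n m = k * sum_n_m u n m.
Proof. exact (sum_n_m_mult_l (K := C_Ring) k u n m). Qed.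

Lemma Csum_RtoC (u : nat -> R) (n m : nat) :
  RtoC (sum_n_m u n m) = sum_n_m (fun k => RtoC (u k)) n m.
Proof.
  destruct (Nat.lt_ge_cases m n) as [Hmn | Hnm].
  - now rewrite !sum_n_m_zero.
  - induction Hnm as [| m Hnm IH]; [now rewrite !sum_n_n |].
    rewrite !sum_n_Sm by lia. rewrite <- IH. apply RtoC_plus.
Qed.

Lemma Csum_at_first (a m : nat) (e : C) (h : nat -> C) :
  (a <= m)%nat ->
  sum_n_m (fun r => (if Nat.eqb r a then e else 0) * h r) a m = e * h a.
Proof.
  intros Ham. rewrite sum_Sn_m, Nat.eqb_refl by easy.
  rewrite (sum_n_m_ext_loc _ (fun _ => zero) (S a) m).
  - rewrite sum_n_m_const_zero. apply plus_zero_r.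
  - intros k Hk. rewrite (proj2 (Nat.eqb_neq k a)) by lia.
    change (RtoC 0 * h k = RtoC 0). Cring.
Qed.

(** Elimination of [A b], the only unknown transform: [A r] with [r < b] is
    explicit, and the equation for [A b] involves [A b] on both sides. *)
Lemma solve_batch_transforms (a b : nat) (x y H d E : C) (K pp Qp A : nat -> C) :
  (1 <= a <= b)%nat -> x <> 0 ->
  E = (1 - d) * sum_n_m Qp 0 (a - 1) ->
  (forall r, (a <= r < b)%nat ->
     A r = (pp r + Qp r + (if Nat.eqb r a then E else 0)) * K r) ->
  x ^ b * A b =
    K b * (sum_n_m A a b
           + H * sum_n_m (fun n => (pp n + d * Qp n) * x ^ n) 0 (a - 1)
           - sum_n_m (fun n => (pp n + Qp n) * x ^ n) 0 (b - 1)
           + (if Nat.eqb a b then E else 0) * x ^ b) ->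
  sum_n_m (fun r => A r * y ^ r) a b * (x ^ b - K b) =
  sum_n_m (fun n =>
      pp n * x ^ n * (H - 1) * y ^ b * K b
      + Qp n * ((1 - d) * ((x ^ b - K b) * y ^ a + y ^ b * K b) * K a
                + (d * H - 1) * x ^ n * y ^ b * K b)) 0 (a - 1)
  + sum_n_m (fun n =>
      (pp n + Qp n)
      * ((x ^ b - K b) * (y ^ n * K n - / x ^ (b - n) * y ^ b * K b)
         + (K n - / x ^ (b - n) * K b) * y ^ b * K b)) a (b - 1).
Proof.
  intros Hab Hx0 HE HA HAb.
  set (P1 := sum_n_m (fun n => pp n * x ^ n) 0 (a - 1)).
  set (Q1 := sum_n_m (fun n => Qp n * x ^ n) 0 (a - 1)).
  set (M := fun z : C => sum_n_m (fun n => (pp n + Qp n) * K n * z ^ n) a (b - 1)).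
  set (X := sum_n_m (fun n => (pp n + Qp n) * x ^ n) a (b - 1)).
  (* Contribution of the dormant starts to batches of size below [b]. When [a = b] these starts
     appear in the equation for [A b] instead. *)
  set (e := fun z : C => if Nat.eqb a b then RtoC 0 else E * (K a * z ^ a)).
  assert (HsumA : forall z, sum_n_m (fun r => A r * z ^ r) a b
                            = M z + e z + A b * z ^ b).
  { intros z. destruct b as [| b']; [lia |].
    rewrite sum_n_Sm by lia.
    match goal with |- plus ?t ?t' = ?r => change (t + t' = r) end.
    f_equal. unfold M, e.
    destruct (Nat.eqb_spec a (S b')) as [-> | Hne].
    - rewrite !sum_n_m_zero by lia. change (RtoC 0 = RtoC 0 + RtoC 0). Cring.
    - rewrite <- (Csum_at_first a b' E (fun r => K r * z ^ r)) by lia.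
      replace (S b' - 1)%nat with b' by lia.
      rewrite <- Csum_plus. apply sum_n_m_ext_loc.
      intros r Hr. rewrite HA by lia. Cring. }
  assert (Hlow : sum_n_m (fun n => (pp n + d * Qp n) * x ^ n) 0 (a - 1)
                 = P1 + d * Q1).
  { unfold P1, Q1. rewrite <- Csum_scal, <- Csum_plus.
    apply sum_n_m_ext. intros n. Cring. }
  assert (Hall : sum_n_m (fun n => (pp n + Qp n) * x ^ n) 0 (b - 1) = P1 + Q1 + X).
  { rewrite (sum_n_m_Chasles _ 0 (a - 1) (b - 1)) by lia.
    replace (S (a - 1)) with a by lia. fold X.
    match goal with |- plus ?t ?t' = ?r => change (t + t' = r) end.
    f_equal. unfold P1, Q1. rewrite <- Csum_plus.
    apply sum_n_m_ext. intros n. Cring. }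
  (* The total over all batch sizes is the case [z = 1]. *)
  assert (HsumA1 : sum_n_m A a b = M 1 + e 1 + A b).
  { transitivity (M 1 + e 1 + A b * 1 ^ b); [| rewrite Cpow_1_l; Cring].
    rewrite <- HsumA. apply sum_n_m_ext. intros n. rewrite Cpow_1_l. Cring. }
  rewrite Hlow, Hall, HsumA1 in HAb. rewrite HsumA.
  (* The first sum of the numerator is expressed by [P1], [Q1] and [E], the second by [M] and
     [X]. *)
  match goal with |- _ = ?s1 + ?s2 =>
    assert (H1 : s1 = y ^ b * K b * (H - 1) * P1
                      + E * ((x ^ b - K b) * y ^ a + y ^ b * K b) * K a
                      + y ^ b * K b * (d * H - 1) * Q1);
    [| assert (H2 : s2 = (x ^ b - K b) * M y + y ^ b * K b * (M 1 - X))]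
  end.
  - rewrite HE. unfold P1, Q1.
    transitivity
      (y ^ b * K b * (H - 1) * sum_n_m (fun n => pp n * x ^ n) 0 (a - 1)
       + (1 - d) * ((x ^ b - K b) * y ^ a + y ^ b * K b) * K a
         * sum_n_m Qp 0 (a - 1)
       + y ^ b * K b * (d * H - 1) * sum_n_m (fun n => Qp n * x ^ n) 0 (a - 1));
      [| Cring].
    rewrite <- !Csum_scal, <- !Csum_plus. apply sum_n_m_ext. intros n. Cring.
  - unfold M, X.
    transitivity
      ((x ^ b - K b) * sum_n_m (fun n => (pp n + Qp n) * K n * y ^ n) a (b - 1)
       + y ^ b * K b * sum_n_m (fun n => (pp n + Qp n) * K n * 1 ^ n) a (b - 1)
       + - (y ^ b * K b) * sum_n_m (fun n => (pp n + Qp n) * x ^ n) a (b - 1));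
      [| Cring].
    rewrite <- !Csum_scal, <- !Csum_plus. apply sum_n_m_ext_loc. intros n Hn.
    (* This factorization lets [field] cancel the inverse of [x ^ (b - n)] and leave [x ^ n]. *)
    replace (x ^ b) with (x ^ n * x ^ (b - n)).
    2: { rewrite <- Cpow_add_r. f_equal. lia. }
    rewrite Cpow_1_l.
    match goal with |- @eq _ ?u ?v => change (@eq C u v) end.
    field. now apply Cpow_nz.
  - rewrite H1, H2. unfold e in *.
    (* After substitution the two occurrences of [K b * A b] cancel, so that [A b * (x ^ b - K b)]
       is explicit. *)
    assert (HAb' : A b * (x ^ b - K b) = x ^ b * A b - K b * A b) by Cring.
    rewrite HAb in HAb'.
    destruct (Nat.eqb_spec a b) as [-> | _].
    + transitivity ((M y + 0) * (x ^ b - K b) + y ^ b * (A b * (x ^ b - K b)));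
        [Cring | rewrite HAb'; ring].
    + transitivity ((M y + E * (K a * y ^ a)) * (x ^ b - K b)
                    + y ^ b * (A b * (x ^ b - K b)));
        [Cring | rewrite HAb', Cpow_1_l; ring].
Qed.

(** * Finitely supported series and finite nonnegative sums *)

Lemma is_Cseries_finite (c : nat -> C) (N : nat) :
  (forall n, (N < n)%nat -> c n = 0) -> is_Cseries c (sum_n_m c 0 N).
Proof.
  intros Hc.
  apply (is_series_decr_n (K := C_AbsRing) (V := C_NormedModule) c (S N)); [lia |].
  apply (is_Cseries_ext (fun _ => zero) _ zero).
  - intros k. symmetry. apply Hc. lia.
  - symmetry. apply (plus_opp_r (sum_n_m c 0 N : C_NormedModule)).
  - apply filterlim_ext with (fun _ : nat => zero : C_NormedModule).
    { intros n. unfold sum_n. now rewrite sum_n_m_const_zero. }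
    apply filterlim_const.
Qed.

Lemma term_le_sum_n_m (g : nat -> R) (a b r : nat) :
  (forall k, (a <= k <= b)%nat -> 0 <= g k)%R -> (a <= r <= b)%nat ->
  (g r <= sum_n_m g a b)%R.
Proof.
  intros Hg Hr.
  (* On this range [g] agrees with its absolute value, so the triangle inequality bounds the sum
     below by a norm. *)
  assert (Hpos : forall n m, (a <= n)%nat -> (m <= b)%nat -> (0 <= sum_n_m g n m)%R).
  { intros n m Hn Hm.
    rewrite (sum_n_m_ext_loc g (fun k => Rabs (g k))).
    - eapply Rle_trans; [apply (norm_ge_0 (sum_n_m g n m : R_NormedModule)) |].
      apply (norm_sum_n_m (V := R_NormedModule) g).
    - intros k Hk. symmetry. apply Rabs_pos_eq, Hg. lia. }
  rewrite (sum_n_m_Chasles g a r b) by lia.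
  destruct r as [| r].
  - replace a with 0%nat by lia. rewrite sum_n_n.
    change (g 0%nat <= g 0%nat + sum_n_m g 1 b)%R.
    assert (H := Hpos 1%nat b ltac:(lia) ltac:(lia)). lra.
  - rewrite sum_n_Sm by lia.
    change (g (S r) <= sum_n_m g a r + g (S r) + sum_n_m g (S (S r)) b)%R.
    assert (H1 := Hpos a r ltac:(lia) ltac:(lia)).
    assert (H2 := Hpos (S (S r)) b ltac:(lia) ltac:(lia)). lra.
Qed.

(** * Balance equations in the shape required by [completion_pgf] *)

Section SteadyState.

Context {a b : nat} {lam delta : R} {s : nat -> nat -> R} {v : nat -> R}
  {p0 : nat -> R} {p : nat -> nat -> nat -> R} {Q : nat -> nat -> R}.
Context (Hmodel : model a b lam delta s v)
  (Hsteady : steady_state a b lam delta s v p0 p Q).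

(* Unnormalized epoch probabilities, tau p^+_{n,r}, tau p^+_n and tau Q^+_n. *)
Definition served_by (n r : nat) : R := with_arrival lam (fun k => p k r 1%nat) n.
Definition served (n : nat) : R := sum_n_m (served_by n) a b.
Definition vacated (n : nat) : R := with_arrival lam (fun k => Q k 1%nat) n.

(* Rate at which a service starts from the end of the dormant period. *)
Definition woken : R := ((1 - delta) * lam * p0 (a - 1)%nat)%R.
(** For [a <= n <= b], the inflow into a batch of size [n] with an empty queue behind it; for
    [n > b], into a batch of size [b] leaving [n - b] waiting. *)
Definition started (n : nat) : R :=
  (served n + vacated n + (if Nat.eqb n a then woken else 0))%R.

Lemma with_arrival_pos (g : nat -> R) (n : nat) :
  (1 <= n)%nat -> with_arrival lam g n = ((1 - lam) * g n + lam * g (n - 1)%nat)%R.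
Proof.
  destruct n as [| n]; [lia |]. intros _. simpl. now rewrite Nat.sub_0_r.
Qed.

Lemma served_pos (n : nat) :
  (1 <= n)%nat ->
  sum_n_m (fun m => (1 - lam) * p n m 1%nat + lam * p (n - 1)%nat m 1%nat)%R a b
  = served n.
Proof.
  intros Hn. apply sum_n_m_ext. intros m. unfold served_by.
  now rewrite with_arrival_pos.
Qed.

Lemma busy_0_balance (r u : nat) :
  (a <= r <= b)%nat -> (1 <= u)%nat ->
  p 0%nat r u = ((1 - lam) * p 0%nat r (u + 1)%nat + started r * s r u)%R.
Proof.
  intros Hr Hu. assert (Ha := a_pos _ _ _ _ _ _ Hmodel).
  unfold started, vacated. destruct (Nat.eqb_spec r a) as [-> | Hne].
  - rewrite (busy_0_a _ _ _ _ _ _ _ _ _ Hsteady) by easy.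
    rewrite served_pos, with_arrival_pos by easy. unfold woken. ring.
  - rewrite (busy_0_r _ _ _ _ _ _ _ _ _ Hsteady) by lia.
    rewrite served_pos, with_arrival_pos by lia. ring.
Qed.

(** A batch smaller than [b] takes everyone waiting, so its service can only begin with an empty
    queue. *)
Lemma busy_lt_b_balance (r n u : nat) :
  (a <= r < b)%nat -> (1 <= u)%nat ->
  p n r u = (with_arrival lam (fun k => p k r (u + 1)%nat) n
             + (if Nat.eqb n 0 then started r else 0) * s r u)%R.
Proof.
  intros Hr Hu. destruct n as [| n].
  - apply busy_0_balance; lia.
  - rewrite (busy_n_r _ _ _ _ _ _ _ _ _ Hsteady) by lia.
    rewrite with_arrival_pos by lia. simpl Nat.eqb. cbv iota. ring.
Qed.

(** A full batch removes [b] customers, whence the shifted index. The dormant term can occur only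
    for [n = 0], when [a = b]. *)
Lemma busy_b_balance (n u : nat) :
  (1 <= u)%nat ->
  p n b u = (with_arrival lam (fun k => p k b (u + 1)%nat) n
             + started (n + b) * s b u)%R.
Proof.
  intros Hu.
  assert (Ha := a_pos _ _ _ _ _ _ Hmodel). assert (Hab := a_le_b _ _ _ _ _ _ Hmodel).
  destruct n as [| n].
  - apply busy_0_balance; lia.
  - rewrite (busy_n_b _ _ _ _ _ _ _ _ _ Hsteady) by lia.
    unfold started, vacated.
    rewrite served_pos, !with_arrival_pos by lia.
    rewrite (proj2 (Nat.eqb_neq (S n + b) a)) by lia. ring.
Qed.

(** Vacations begin only with fewer than [a] waiting: after a service, or after another vacation
    when [delta = 1]. *)
Lemma vacation_balance (n u : nat) :
  (1 <= u)%nat ->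
  Q n u = (with_arrival lam (fun k => Q k (u + 1)%nat) n
           + (if Nat.ltb n a then served n + delta * vacated n else 0) * v u)%R.
Proof.
  intros Hu. assert (Ha := a_pos _ _ _ _ _ _ Hmodel).
  unfold vacated.
  destruct n as [| n]; [| destruct (Nat.ltb_spec (S n) a) as [Hlt | Hge]].
  - rewrite (proj2 (Nat.ltb_lt 0 a)) by lia.
    rewrite (vacation_0 _ _ _ _ _ _ _ _ _ Hsteady) by easy.
    unfold served, served_by, with_arrival.
    assert (Hfactor : sum_n_m (fun r => (1 - lam) * p 0%nat r 1%nat)%R a b
                      = ((1 - lam) * sum_n_m (fun r => p 0%nat r 1%nat) a b)%R)
      by apply (sum_n_m_mult_l (K := R_Ring)).
    rewrite Hfactor. ring.
  - rewrite (vacation_lt_a _ _ _ _ _ _ _ _ _ Hsteady) by lia.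
    rewrite served_pos, !with_arrival_pos by lia. ring.
  - rewrite (vacation_ge_a _ _ _ _ _ _ _ _ _ Hsteady) by lia.
    rewrite with_arrival_pos by lia. ring.
Qed.

(* Single vacation: the dormant equations telescope to
   [lam p0(n) = sum of vacated k, k <= n]. *)
Lemma woken_eq : woken = ((1 - delta) * sum_n_m vacated 0 (a - 1))%R.
Proof.
  assert (Ha := a_pos _ _ _ _ _ _ Hmodel).
  unfold woken. destruct (delta_01 _ _ _ _ _ _ Hmodel) as [Hd | Hd].
  2: { rewrite Hd. ring. }
  rewrite Rmult_assoc. f_equal.
  enough (H : forall n, (n <= a - 1)%nat -> (lam * p0 n = sum_n_m vacated 0 n)%R)
    by now apply H.
  induction n as [| n IH]; intros Hn.
  - rewrite sum_n_n. assert (H := dormant_0 _ _ _ _ _ _ _ _ _ Hsteady).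
    unfold vacated, with_arrival. rewrite Hd in H. lra.
  - rewrite sum_n_Sm by lia. rewrite <- IH by lia.
    change (lam * p0 (S n) = lam * p0 n + vacated (S n))%R.
    assert (H := dormant_n _ _ _ _ _ _ _ _ _ Hsteady (S n) ltac:(lia)).
    unfold vacated. rewrite with_arrival_pos by lia.
    replace (S n - 1)%nat with n in * by lia. rewrite Hd in H. lra.
Qed.

(** The normalization controls only the sum over all batch sizes; by nonnegativity it dominates each
    size separately. *)
Lemma busy_doubly_summable (r : nat) :
  (a <= r <= b)%nat -> doubly_summable (fun n u => p n r (S u)).
Proof.
  intros Hr.
  assert (Hpos : forall k n u, (a <= k <= b)%nat -> (0 <= p n k (S u))%R).
  { intros k n u Hk. apply (busy_nonneg _ _ _ _ _ _ _ _ _ Hsteady); lia. }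
  assert (Hser : forall k n, (a <= k <= b)%nat -> (0 <= Series (fun u => p n k (S u)))%R).
  { intros k n Hk. eapply Rle_trans; [apply (Hpos k n 0%nat Hk) |].
    apply (term_le_Series (fun u => p n k (S u))); [intros u; now apply Hpos |].
    now apply (busy_summable_u _ _ _ _ _ _ _ _ _ Hsteady). }
  split; [intros n u; now apply Hpos | split].
  - intros n. now apply (busy_summable_u _ _ _ _ _ _ _ _ _ Hsteady).
  - apply ex_series_nonneg_le with (2 := busy_summable _ _ _ _ _ _ _ _ _ Hsteady).
    intros n. split; [now apply Hser |].
    apply (term_le_sum_n_m (fun k => Series (fun u => p n k (S u)))); [| easy].
    intros k Hk. now apply Hser.
Qed.

Lemma vacation_doubly_summable : doubly_summable (fun n u => Q n (S u)).
Proof.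
  split; [| split].
  - intros n u. apply (vacation_nonneg _ _ _ _ _ _ _ _ _ Hsteady). lia.
  - apply (vacation_summable_u _ _ _ _ _ _ _ _ _ Hsteady).
  - apply (vacation_summable _ _ _ _ _ _ _ _ _ Hsteady).
Qed.

(** * Transforms at completion epochs *)

(** Convergence known beforehand: the transform of size [b] must be a genuine sum before the
    equation containing it on both sides is derived. *)
Lemma is_Cseries_completions (f : nat -> nat -> R) (x : C) :
  doubly_summable (fun n u => f n (S u)) -> (Cmod x <= 1)%R ->
  let c := fun n => RtoC (with_arrival lam (fun k => f k 1%nat) n) * x ^ n in
  is_Cseries c (CSeries c).
Proof.
  intros Hf Hx c.
  assert (H : is_Cseries (fun n => RtoC (f n 1%nat) * x ^ n)
                (CSeries (fun n => RtoC (f n 1%nat) * x ^ n))).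
  { apply (power_series_CSeries (fun n => f n 1%nat) (fun n => n)); [| | easy].
    - intros n. apply (proj1 Hf).
    - apply (ex_series_column _ 0%nat Hf). }
  apply (is_Cseries_with_arrival lam) in H. unfold c.
  now rewrite (CSeries_unique _ _ H).
Qed.

Definition served_pgf (x : C) (r : nat) : C :=
  CSeries (fun n => RtoC (served_by n r) * x ^ n).

Lemma served_pgf_lt_b (x : C) (r : nat) :
  (Cmod x <= 1)%R -> (a <= r < b)%nat ->
  served_pgf x r = RtoC (started r) * arrivals_pgf lam (s r) x.
Proof.
  intros Hx Hr. apply CSeries_unique.
  apply (completion_pgf lam (fun n u => p n r u)
           (fun n => if Nat.eqb n 0 then started r else 0%R) (s r)); try easy.
  - apply (lam_range _ _ _ _ _ _ Hmodel).
  - apply (service_pmf _ _ _ _ _ _ Hmodel). lia.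
  - apply busy_doubly_summable. lia.
  - intros n u Hu. now apply busy_lt_b_balance.
  - eapply is_Cseries_ext; [reflexivity | | apply (is_Cseries_finite _ 0)].
    + rewrite sum_n_n. simpl. Cring.
    + intros [| n] Hn; [lia |]. simpl Nat.eqb. cbv iota. ring.
Qed.

Lemma vacated_series (x : C) :
  (Cmod x <= 1)%R ->
  is_Cseries (fun n => RtoC (vacated n) * x ^ n)
    (sum_n_m (fun n => (RtoC (served n) + RtoC delta * RtoC (vacated n)) * x ^ n)
       0 (a - 1) * arrivals_pgf lam v x).
Proof.
  intros Hx. assert (Ha := a_pos _ _ _ _ _ _ Hmodel).
  apply (completion_pgf lam Q
           (fun n => if Nat.ltb n a then (served n + delta * vacated n)%R else 0%R) v);
    try easy.
  - apply (lam_range _ _ _ _ _ _ Hmodel).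
  - apply (vacation_pmf _ _ _ _ _ _ Hmodel).
  - apply vacation_doubly_summable.
  - intros n u Hu. now apply vacation_balance.
  - eapply is_Cseries_ext; [reflexivity | | apply (is_Cseries_finite _ (a - 1))].
    + apply sum_n_m_ext_loc. intros n Hn.
      rewrite (proj2 (Nat.ltb_lt n a)) by lia. now rewrite RtoC_plus, RtoC_mult.
    + intros n Hn. rewrite (proj2 (Nat.ltb_ge n a)) by lia. ring.
Qed.

Lemma served_by_series (x : C) (r : nat) :
  (Cmod x <= 1)%R -> (a <= r <= b)%nat ->
  is_Cseries (fun n => RtoC (served_by n r) * x ^ n) (served_pgf x r).
Proof.
  intros Hx Hr.
  apply (is_Cseries_completions (fun n u => p n r u)); [| assumption].
  apply busy_doubly_summable. assumption.
Qed.

Lemma served_pgf_b (x : C) :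
  (Cmod x <= 1)%R -> x <> 0 ->
  x ^ b * served_pgf x b =
    arrivals_pgf lam (s b) x
    * (sum_n_m (served_pgf x) a b
       + arrivals_pgf lam v x
         * sum_n_m (fun n => (RtoC (served n) + RtoC delta * RtoC (vacated n)) * x ^ n)
             0 (a - 1)
       - sum_n_m (fun n => (RtoC (served n) + RtoC (vacated n)) * x ^ n) 0 (b - 1)
       + (if Nat.eqb a b then RtoC woken else RtoC 0) * x ^ b).
Proof.
  intros Hx Hx0.
  assert (Ha := a_pos _ _ _ _ _ _ Hmodel). assert (Hab := a_le_b _ _ _ _ _ _ Hmodel).
  set (V := arrivals_pgf lam v x * _).
  set (low := sum_n_m _ 0 (b - 1)).
  (* Generating function of all epochs, service completions and vacation ends together. *)
  assert (Hall : is_Cseries (fun n => (RtoC (served n) + RtoC (vacated n)) * x ^ n)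
                   (sum_n_m (served_pgf x) a b + V)).
  { eapply is_Cseries_ext;
      [ | | apply is_Cseries_plus;
            [ apply (is_series_sum_n_m (K := C_AbsRing) (V := C_NormedModule)
                       (fun r n => RtoC (served_by n r) * x ^ n) (served_pgf x));
              intros r Hr; now apply served_by_series
            | now apply (vacated_series x) ] ].
    - intros n. cbn beta. rewrite Cmult_plus_distr_r. f_equal.
      unfold served. rewrite Csum_RtoC.
      rewrite (Cmult_comm (sum_n_m _ a b)), <- Csum_scal.
      apply sum_n_m_ext. intros r. Cring.
    - unfold V. cbn beta. f_equal. ring. }
  (* Inflow into full batches: the first [b] terms are removed, the tail is divided by [x ^ b], and
     the dormant starts are added if [a = b]. *)
  assert (Hhigh : is_Cseries (fun n => RtoC (started (n + b)) * x ^ n)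
            (/ x ^ b * (sum_n_m (served_pgf x) a b + V - low)
             + (if Nat.eqb a b then RtoC woken else RtoC 0))).
  { assert (Hshift : is_Cseries
       (fun n => (RtoC (served (b + n)) + RtoC (vacated (b + n))) * x ^ (b + n))
       (sum_n_m (served_pgf x) a b + V - low)).
    { apply (is_series_incr_n (K := C_AbsRing) (V := C_NormedModule)
               (fun n => (RtoC (served n) + RtoC (vacated n)) * x ^ n) b); [lia |].
      eapply is_Cseries_ext; [reflexivity | | apply Hall].
      change (sum_n_m (served_pgf x) a b + V
              = (sum_n_m (served_pgf x) a b + V - low)
                + sum_n_m (fun n => (RtoC (served n) + RtoC (vacated n)) * x ^ n)
                    0 (pred b)).
      replace (pred b) with (b - 1)%nat by lia. fold low. ring. }
    eapply is_Cseries_ext;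
      [ | | apply is_Cseries_plus;
            [ apply (is_Cseries_scal (/ x ^ b)), Hshift
            | apply (is_Cseries_finite
                       (fun n => if Nat.eqb n 0 then
                                   if Nat.eqb a b then RtoC woken else RtoC 0
                                 else RtoC 0) 0) ] ].
    - intros n. cbn beta. unfold started. rewrite (Nat.add_comm n b).
      rewrite Cpow_add_r, !RtoC_plus.
      replace (RtoC (if Nat.eqb (b + n) a then woken else 0%R))
        with (if Nat.eqb n 0 then if Nat.eqb a b then RtoC woken else RtoC 0 else RtoC 0).
      + destruct (Nat.eqb_spec n 0) as [-> | Hn].
        * simpl. field. now apply Cpow_nz.
        * field. now apply Cpow_nz.
      (* As [a <= b], the equality [b + n = a] means [n = 0] and [a = b]. *)
      + destruct (Nat.eqb_spec n 0), (Nat.eqb_spec a b), (Nat.eqb_spec (b + n) a);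
          try easy; lia.
    - rewrite sum_n_n. reflexivity.
    - intros [| n] Hn; [lia | reflexivity]. }
  assert (Hb : served_pgf x b
               = (/ x ^ b * (sum_n_m (served_pgf x) a b + V - low)
                  + (if Nat.eqb a b then RtoC woken else RtoC 0))
                 * arrivals_pgf lam (s b) x).
  { apply CSeries_unique.
    apply (completion_pgf lam (fun n u => p n b u) (fun n => started (n + b)) (s b));
      try easy.
    - apply (lam_range _ _ _ _ _ _ Hmodel).
    - apply (service_pmf _ _ _ _ _ _ Hmodel). lia.
    - apply busy_doubly_summable. lia.
    - intros n u Hu. now apply busy_b_balance. }
  rewrite Hb. field. now apply Cpow_nz.
Qed.

(** * Scaling by the inverse of [tau], and assembly *)

Lemma pplus_served_by (n r : nat) :
  pplus a b lam p Q n r = (/ tau a b p Q * served_by n r)%R.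
Proof. now destruct n. Qed.

Lemma pplus_tot_served (n : nat) :
  pplus_tot a b lam p Q n = (/ tau a b p Q * served n)%R.
Proof.
  unfold pplus_tot, served.
  rewrite <- (sum_n_m_mult_l (K := R_Ring) (/ tau a b p Q)%R (served_by n)).
  apply sum_n_m_ext. intros r. apply pplus_served_by.
Qed.

Lemma Qplus_vacated (n : nat) :
  Qplus a b lam p Q n = (/ tau a b p Q * vacated n)%R.
Proof. now destruct n. Qed.

End SteadyState.

Theorem mainTheorem1 (a b : nat) (lam delta : R) (s : nat -> nat -> R)
    (v : nat -> R) (p0 : nat -> R) (p : nat -> nat -> nat -> R)
    (Q : nat -> nat -> R)
    (Hmodel : model a b lam delta s v)
    (Hsteady : steady_state a b lam delta s v p0 p Q)
    (x y : C) (Hx : (Cmod x <= 1)%R) (Hy : (Cmod y <= 1)%R)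
    (Hx0 : x <> 0) (HxK : x ^ b <> arrivals_pgf lam (s b) x) :
  @ex_series C_AbsRing C_NormedModule (PGFplus_term a b lam p Q x y) /\
  PGFplus a b lam p Q x y
  = numerator a b lam delta s v p Q x y / (x ^ b - arrivals_pgf lam (s b) x).
Proof.
  assert (Ha := a_pos _ _ _ _ _ _ Hmodel). assert (Hab := a_le_b _ _ _ _ _ _ Hmodel).
  set (c := RtoC (/ tau a b p Q)).
  set (A := fun r => c * served_pgf (lam := lam) (p := p) x r).
  assert (Hseries : is_Cseries (PGFplus_term a b lam p Q x y)
                      (sum_n_m (fun r => A r * y ^ r) a b)).
  { apply (is_series_sum_n_m (K := C_AbsRing) (V := C_NormedModule)
             (fun r n => RtoC (pplus a b lam p Q n r) * x ^ n * y ^ r)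
             (fun r => A r * y ^ r)).
    intros r Hr.
    eapply is_Cseries_ext;
      [ | | apply (is_Cseries_scal (c * y ^ r)), (served_by_series Hsteady x r Hx Hr) ].
    - intros n. cbn beta. rewrite pplus_served_by, RtoC_mult. fold c. ring.
    - unfold A. cbn beta. ring. }
  split; [eexists; exact Hseries |].
  unfold PGFplus. rewrite (CSeries_unique _ _ Hseries).
  assert (Hpp : forall n, RtoC (pplus_tot a b lam p Q n)
                          = c * RtoC (served (a := a) (b := b) (lam := lam) (p := p) n)).
  { intros n. now rewrite pplus_tot_served, RtoC_mult. }
  assert (HQp : forall n, RtoC (Qplus a b lam p Q n)
                          = c * RtoC (vacated (lam := lam) (Q := Q) n)).
  { intros n. now rewrite Qplus_vacated, RtoC_mult. }
  set (E := c * RtoC (woken (a := a) (lam := lam) (delta := delta) (p0 := p0))).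
  unfold numerator.
  rewrite <- (solve_batch_transforms a b x y (arrivals_pgf lam v x) (RtoC delta) E
                (fun r => arrivals_pgf lam (s r) x)
                (fun n => RtoC (pplus_tot a b lam p Q n))
                (fun n => RtoC (Qplus a b lam p Q n)) A); try easy.
  - unfold Cdiv. rewrite <- Cmult_assoc, Cinv_r, Cmult_1_r; [reflexivity |].
    now apply Cminus_eq_contra.
  - unfold E. rewrite (woken_eq Hmodel Hsteady), RtoC_mult, RtoC_minus, Csum_RtoC.
    rewrite (sum_n_m_ext (fun n => RtoC (Qplus a b lam p Q n)) _ 0 (a - 1) HQp).
    rewrite Csum_scal. ring.
  - intros r Hr. unfold A, E.
    rewrite (served_pgf_lt_b Hmodel Hsteady x r Hx Hr), Hpp, HQp.
    unfold started. destruct (Nat.eqb r a); rewrite !RtoC_plus; ring.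
  (* The equation of [served_pgf_b] multiplied by [c]; the rewrites below move [c] out of both
     finite sums. *)
  - unfold A at 1. rewrite (Cmult_comm c), Cmult_assoc.
    rewrite (served_pgf_b Hmodel Hsteady x Hx Hx0).
    unfold A, E. rewrite Csum_scal.
    rewrite (sum_n_m_ext
      (fun n => (RtoC (pplus_tot a b lam p Q n)
                 + RtoC delta * RtoC (Qplus a b lam p Q n)) * x ^ n)
      (fun n => c * ((RtoC (served (a := a) (b := b) (lam := lam) (p := p) n)
                      + RtoC delta * RtoC (vacated (lam := lam) (Q := Q) n)) * x ^ n))).
    2: { intros n. rewrite Hpp, HQp. Cring. }
    rewrite (sum_n_m_ext
      (fun n => (RtoC (pplus_tot a b lam p Q n) + RtoC (Qplus a b lam p Q n)) * x ^ n)
      (fun n => c * ((RtoC (served (a := a) (b := b) (lam := lam) (p := p) n)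
                      + RtoC (vacated (lam := lam) (Q := Q) n)) * x ^ n))).
    2: { intros n. rewrite Hpp, HQp. Cring. }
    rewrite !Csum_scal. destruct (Nat.eqb a b); Cring.
Qed.
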